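(* Let $\mathbb{D}$ be a division ring, $M\ge N\ge 3$, and let $\boldsymbol{x}:\mathbb{Z}^N\to\mathbb{D}^M$ be a quadrilateral lattice with forward data $(\boldsymbol{X}_i,H_i,Q_{ij})$. Let $K=K_a+K_b$ with $K_a,K_b\ge1$, and let $(\boldsymbol{Y}_i,\boldsymbol{Y}^*_i)$ with potentials $\boldsymbol{\Omega}(\boldsymbol{Y},\boldsymbol{Y}^* )$, $\boldsymbol{\Omega}(\boldsymbol{X},\boldsymbol{Y}^* )$, $\boldsymbol{\Omega}(\boldsymbol{Y},H)$ be data of a vectorial fundamental transformation $\boldsymbol{x}\to\boldsymbol{x}'$ of size $K$. Split, according to $\mathbb{D}^K=\mathbb{D}^{K_a}\oplus\mathbb{D}^{K_b}$, $$\boldsymbol{Y}_i=\begin{pmatrix}\boldsymbol{Y}^a_i\\ \boldsymbol{Y}^b_i\end{pmatrix},\quad \boldsymbol{Y}^*_i=\begin{pmatrix}\boldsymbol{Y}^*_{ai}&\boldsymbol{Y}^*_{bi}\end{pmatrix},\quad \boldsymbol{\Omega}(\boldsymbol{Y},H)=\begin{pmatrix}\boldsymbol{\Omega}(\boldsymbol{Y}^a,H)\\ \boldsymbol{\Omega}(\boldsymbol{Y}^b,H)\end{pmatrix},$$ $$\boldsymbol{\Omega}(\boldsymbol{Y},\boldsymbol{Y}^* )=\begin{pmatrix}\boldsymbol{\Omega}(\boldsymbol{Y}^a,\boldsymbol{Y}^*_a)&\boldsymbol{\Omega}(\boldsymbol{Y}^a,\boldsymbol{Y}^*_b)\\ \boldsymbol{\Omega}(\boldsymbol{Y}^b,\boldsymbol{Y}^*_a)&\boldsymbol{\Omega}(\boldsymbol{Y}^b,\boldsymbol{Y}^*_b)\end{pmatrix},\quad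 \boldsymbol{\Omega}(\boldsymbol{X},\boldsymbol{Y}^* )=\begin{pmatrix}\boldsymbol{\Omega}(\boldsymbol{X},\boldsymbol{Y}^*_a)&\boldsymbol{\Omega}(\boldsymbol{X},\boldsymbol{Y}^*_b)\end{pmatrix}.$$ Assume that $\boldsymbol{\Omega}(\boldsymbol{Y},\boldsymbol{Y}^* )$ and $\boldsymbol{\Omega}(\boldsymbol{Y}^a,\boldsymbol{Y}^*_a)$ are invertible at every point of $\mathbb{Z}^N$. Then the vectorial fundamental transformation $\boldsymbol{x}\to\boldsymbol{x}'$ is equivalent to the following superposition of vectorial fundamental transformations. 1) The transformation $\boldsymbol{x}\to\boldsymbol{x}^{\{a\}}$ with data $\boldsymbol{Y}^a_i,\boldsymbol{Y}^*_{ai}$ and potentials $\boldsymbol{\Omega}(\boldsymbol{Y}^a,H)$, $\boldsymbol{\Omega}(\boldsymbol{Y}^a,\boldsymbol{Y}^*_a)$, $\boldsymbol{\Omega}(\boldsymbol{X},\boldsymbol{Y}^*_a)$: $$\boldsymbol{x}^{\{a\}}=\boldsymbol{x}-\boldsymbol{\Omega}(\boldsymbol{X},\boldsymbol{Y}^*_a)\boldsymbol{\Omega}(\boldsymbol{Y}^a,\boldsymbol{Y}^*_a)^{-1}\boldsymbol{\Omega}(\boldsymbol{Y}^a,H),$$ $$\boldsymbol{X}^{\{a\}}_i=\boldsymbol{X}_i-\boldsymbol{\Omega}(\boldsymbol{X},\boldsymbol{Y}^*_a)\boldsymbol{\Omega}(\boldsymbol{Y}^a,\boldsymbol{Y}^*_a)^{-1}\boldsymbol{Y}^a_i,\qquad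 H_i^{\{a\}}=H_i-\boldsymbol{Y}^*_{ai}\boldsymbol{\Omega}(\boldsymbol{Y}^a,\boldsymbol{Y}^*_a)^{-1}\boldsymbol{\Omega}(\boldsymbol{Y}^a,H).$$ 2) The vectorial fundamental transformation applied to $\boldsymbol{x}^{\{a\}}$ with the transformed data $$\boldsymbol{Y}_i^{b\{a\}}=\boldsymbol{Y}^b_i-\boldsymbol{\Omega}(\boldsymbol{Y}^b,\boldsymbol{Y}^*_a)\boldsymbol{\Omega}(\boldsymbol{Y}^a,\boldsymbol{Y}^*_a)^{-1}\boldsymbol{Y}^a_i,\qquad \boldsymbol{Y}^{*\{a\}}_{bi}=\boldsymbol{Y}^*_{bi}-\boldsymbol{Y}^*_{ai}\boldsymbol{\Omega}(\boldsymbol{Y}^a,\boldsymbol{Y}^*_a)^{-1}\boldsymbol{\Omega}(\boldsymbol{Y}^a,\boldsymbol{Y}^*_b),$$ and potentials $$\boldsymbol{\Omega}(\boldsymbol{Y}^b,H)^{\{a\}}=\boldsymbol{\Omega}(\boldsymbol{Y}^b,H)-\boldsymbol{\Omega}(\boldsymbol{Y}^b,\boldsymbol{Y}^*_a)\boldsymbol{\Omega}(\boldsymbol{Y}^a,\boldsymbol{Y}^*_a)^{-1}\boldsymbol{\Omega}(\boldsymbol{Y}^a,H),$$ $$\boldsymbol{\Omega}(\boldsymbol{Y}^b,\boldsymbol{Y}^*_b)^{\{a\}}=\boldsymbol{\Omega}(\boldsymbol{Y}^b,\boldsymbol{Y}^*_b)-\boldsymbol{\Omega}(\boldsymbol{Y}^b,\boldsymbol{Y}^*_a)\boldsymbol{\Omega}(\boldsymbol{Y}^a,\boldsymbol{Y}^*_a)^{-1}\boldsymbol{\Omega}(\boldsymbol{Y}^a,\boldsymbol{Y}^*_b),$$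 $$\boldsymbol{\Omega}(\boldsymbol{X},\boldsymbol{Y}^*_b)^{\{a\}}=\boldsymbol{\Omega}(\boldsymbol{X},\boldsymbol{Y}^*_b)-\boldsymbol{\Omega}(\boldsymbol{X},\boldsymbol{Y}^*_a)\boldsymbol{\Omega}(\boldsymbol{Y}^a,\boldsymbol{Y}^*_a)^{-1}\boldsymbol{\Omega}(\boldsymbol{Y}^a,\boldsymbol{Y}^*_b).$$ That is: $(\boldsymbol{Y}_i^{b\{a\}},\boldsymbol{Y}^{*\{a\}}_{bi})$ together with these three potentials are data of a vectorial fundamental transformation of size $K_b$ of the lattice $\boldsymbol{x}^{\{a\}}$ with forward data $\boldsymbol{X}_i^{\{a\}}$, $H_i^{\{a\}}$, $Q_{ij}^{\{a\}}=Q_{ij}-\boldsymbol{Y}^*_{aj}\boldsymbol{\Omega}(\boldsymbol{Y}^a,\boldsymbol{Y}^*_a)^{-1}\boldsymbol{Y}^a_i$ (in particular the three functions are, respectively, potentials $\boldsymbol{\Omega}(\boldsymbol{Y}^{b\{a\}},H^{\{a\}})$, $\boldsymbol{\Omega}(\boldsymbol{Y}^{b\{a\}},\boldsymbol{Y}_b^{*\{a\}})$, $\boldsymbol{\Omega}(\boldsymbol{X}^{\{a\}},\boldsymbol{Y}_b^{*\{a\}})$), and $$\boldsymbol{x}'=\boldsymbol{x}^{\{a\}}-\boldsymbol{\Omega}(\boldsymbol{X},\boldsymbol{Y}^*_b)^{\{a\}}\,[\boldsymbol{\Omega}(\boldsymbol{Y}^b,\boldsymbol{Y}^*_b)^{\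{a\}}]^{-1}\,\boldsymbol{\Omega}(\boldsymbol{Y}^b,H)^{\{a\}}.$$
   Context: $\mathbb{D}$ is a division ring (not necessarily commutative). $\mathbb{D}^M$ is a right vector space of column vectors (scalars multiply on the right); $(\mathbb{D}^K)^*$ consists of row vectors (scalars multiply on the left). For a column $v$ and a row $w$, $v\otimes w$ is the matrix product $vw$; for a scalar $h$, $v\otimes h=vh$. $T_i$ is the translation operator in the $i$-th direction, $(T_if)(n)=f(n+e_i)$, and $\Delta_i=T_i-\mathrm{id}$; $T_i$ acts only on the symbol immediately following it. A map $\boldsymbol{x}:\mathbb{Z}^N\to\mathbb{D}^M$ is a quadrilateral lattice if for all $i\ne j$ the points $\boldsymbol{x},T_i\boldsymbol{x},T_j\boldsymbol{x},T_iT_j\boldsymbol{x}$ are coplanar, at every point of $\mathbb{Z}^N$. Its forward data are functions $\boldsymbol{X}_i:\mathbb{Z}^N\to\mathbb{D}^M$, $H_i:\mathbb{Z}^N\to\mathbb{D}$, $Q_{ij}:\mathbb{Z}^N\to\mathbb{D}$ ($i\neq j$) satisfying $$\Delta_i\boldsymbol{x}=\boldsymbol{X}_iT_iH_i,\quad \Delta_iH_j=Q_{ij}T_iH_i,\quad \Delta_j\boldsymbol{X}_i=\boldsymbol{X}_jT_jQ_{ij}\ (i\ne j),$$ together with the compatibility conditions $\Delta_kQ_{ij}=Q_{kj}T_kQ_{ik}$ ($i,j,k$ distinct). Data of a vectorial fundamental transformation of size $K$ of $\boldsymbol{x}$ (with given forward data): functions $\boldsymbol{Y}_i:\mathbb{Z}^N\to\mathbb{D}^K$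 (columns) and $\boldsymbol{Y}^*_i:\mathbb{Z}^N\to(\mathbb{D}^K)^*$ (rows) with $$\Delta_j\boldsymbol{Y}_i=\boldsymbol{Y}_j\,T_jQ_{ij},\qquad \Delta_i\boldsymbol{Y}^*_j=Q_{ij}\,T_i\boldsymbol{Y}^*_i\qquad (i\neq j),$$ and potentials $\boldsymbol{\Omega}(\boldsymbol{Y},\boldsymbol{Y}^* )$ ($K\times K$ matrix valued), $\boldsymbol{\Omega}(\boldsymbol{X},\boldsymbol{Y}^* )$ ($M\times K$ matrix valued), $\boldsymbol{\Omega}(\boldsymbol{Y},H)$ ($\mathbb{D}^K$ valued) with $$\Delta_i\boldsymbol{\Omega}(\boldsymbol{Y},\boldsymbol{Y}^* )=\boldsymbol{Y}_i\otimes T_i\boldsymbol{Y}^*_i,\quad \Delta_i\boldsymbol{\Omega}(\boldsymbol{X},\boldsymbol{Y}^* )=\boldsymbol{X}_i\otimes T_i\boldsymbol{Y}^*_i,\quad \Delta_i\boldsymbol{\Omega}(\boldsymbol{Y},H)=\boldsymbol{Y}_i\otimes T_iH_i\quad(i=1,\dots,N),$$ such that $\boldsymbol{\Omega}(\boldsymbol{Y},\boldsymbol{Y}^* )$ is invertible at every point. In general a function is called a potential $\boldsymbol{\Omega}(\boldsymbol{Z},\boldsymbol{Z}^* )$ if $\Delta_i\boldsymbol{\Omega}(\boldsymbol{Z},\boldsymbol{Z}^* )=\boldsymbol{Z}_i\otimes T_i\boldsymbol{Z}^*_i$ for all $i$ (potentials are determined up to additive constants). The vectorial fundamental transform of $\boldsymbol{x}$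 is $$\boldsymbol{x}'=\boldsymbol{x}-\boldsymbol{\Omega}(\boldsymbol{X},\boldsymbol{Y}^* )\boldsymbol{\Omega}(\boldsymbol{Y},\boldsymbol{Y}^* )^{-1}\boldsymbol{\Omega}(\boldsymbol{Y},H),$$ a quadrilateral lattice with forward data $H_i'=H_i-\boldsymbol{Y}^*_i\boldsymbol{\Omega}(\boldsymbol{Y},\boldsymbol{Y}^* )^{-1}\boldsymbol{\Omega}(\boldsymbol{Y},H)$, $\boldsymbol{X}_i'=\boldsymbol{X}_i-\boldsymbol{\Omega}(\boldsymbol{X},\boldsymbol{Y}^* )\boldsymbol{\Omega}(\boldsymbol{Y},\boldsymbol{Y}^* )^{-1}\boldsymbol{Y}_i$, $Q_{ij}'=Q_{ij}-\boldsymbol{Y}^*_j\boldsymbol{\Omega}(\boldsymbol{Y},\boldsymbol{Y}^* )^{-1}\boldsymbol{Y}_i$. *)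

(* Defs.v *)
From HB Require Import structures.
From mathcomp Require Import all_boot all_order all_algebra.
From mathcomp Require Import boolp classical_sets.

Set Implicit Arguments.
Unset Strict Implicit.
Unset Printing Implicit Defensive.

Import GRing.Theory.
Local Open Scope ring_scope.

(* A unitRingType is nontrivial and not assumed commutative. *)
Definition division_ring (D : unitRingType) : Prop :=
  forall d : D, d != 0 -> d \is a GRing.unit.

(* The library's unitmx and invmx go through the determinant and require a
   commutative ring, so invertibility and the inverse are restated here. *)
Section MatrixInverse.
Variables (D : unitRingType) (K : nat).

Definition mx_inverse_of (A B : 'M[D]_K) : Prop :=
  A *m B = 1%:M /\ B *m A = 1%:M.

Definition mx_invertible (A : 'M[D]_K) : Prop := exists B, mx_inverse_of A B.

(* Equal to 0 when A is not invertible. *)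
Definition mxinv (A : 'M[D]_K) : 'M[D]_K := xget 0 (mx_inverse_of A).

Lemma mxinvP (A : 'M[D]_K) : mx_invertible A -> mx_inverse_of A (mxinv A).
Proof. exact: xgetPex. Qed.

End MatrixInverse.

Section Lattice.
Variable N : nat.

Definition Tr (V : Type) (i : 'I_N) (f : 'rV[int]_N -> V) : 'rV[int]_N -> V :=
  fun n => f (n + delta_mx 0 i).

Definition Df (V : zmodType) (i : 'I_N) (f : 'rV[int]_N -> V) :
  'rV[int]_N -> V := fun n => Tr i f n - f n.

Variable D : unitRingType.

(* Columns form a right vector space: the product v h of a column by a scalar
   is v *m h%:M with h%:M of size 1.  (The library's scaling a *: A multiplies
   on the left and is used for rows.) *)

Definition coplanar (M : nat) (s : seq 'cV[D]_M) : Prop :=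
  exists p u v : 'cV[D]_M,
    (forall a b : D, u *m a%:M + v *m b%:M = 0 -> a = 0 /\ b = 0) /\
    (forall y, y \in s -> exists a b : D, y = p + u *m a%:M + v *m b%:M).

Definition quadrilateral_lattice (M : nat) (x : 'rV[int]_N -> 'cV[D]_M) : Prop :=
  forall (i j : 'I_N) (n : 'rV[int]_N), i != j ->
    coplanar [:: x n; Tr i x n; Tr j x n; Tr i (Tr j x) n].

(* The diagonal entries Q i i are never constrained nor used. *)
Record forward_data (M : nat) (x : 'rV[int]_N -> 'cV[D]_M)
    (X : 'I_N -> 'rV[int]_N -> 'cV[D]_M) (H : 'I_N -> 'rV[int]_N -> D)
    (Q : 'I_N -> 'I_N -> 'rV[int]_N -> D) : Prop := ForwardData {
  fd_x : forall i n, Df i x n = X i n *m (Tr i (H i) n)%:M;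
  fd_H : forall i j n, i != j -> Df i (H j) n = Q i j n * Tr i (H i) n;
  fd_X : forall i j n, i != j -> Df j (X i) n = X j n *m (Tr j (Q i j) n)%:M;
  fd_Q : forall i j k n, i != j -> j != k -> i != k ->
    Df k (Q i j) n = Q k j n * Tr k (Q i k) n
}.

Definition potential (p q : nat) (Z : 'I_N -> 'rV[int]_N -> 'cV[D]_p)
    (Zs : 'I_N -> 'rV[int]_N -> 'rV[D]_q) (O : 'rV[int]_N -> 'M[D]_(p, q)) :
  Prop := forall i n, Df i O n = Z i n *m Tr i (Zs i) n.

(* In O_YH the scalars H are seen as rows of length 1. *)
Record vft_data (M K : nat) (X : 'I_N -> 'rV[int]_N -> 'cV[D]_M)
    (H : 'I_N -> 'rV[int]_N -> D) (Q : 'I_N -> 'I_N -> 'rV[int]_N -> D)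
    (Y : 'I_N -> 'rV[int]_N -> 'cV[D]_K) (Ys : 'I_N -> 'rV[int]_N -> 'rV[D]_K)
    (O_YYs : 'rV[int]_N -> 'M[D]_K) (O_XYs : 'rV[int]_N -> 'M[D]_(M, K))
    (O_YH : 'rV[int]_N -> 'cV[D]_K) : Prop := VftData {
  vft_Y : forall i j n, i != j -> Df j (Y i) n = Y j n *m (Tr j (Q i j) n)%:M;
  vft_Ys : forall i j n, i != j -> Df i (Ys j) n = Q i j n *: Tr i (Ys i) n;
  vft_YYs : potential Y Ys O_YYs;
  vft_XYs : potential X Ys O_XYs;
  vft_YH : potential Y (fun i n => (H i n)%:M) O_YH;
  vft_inv : forall n, mx_invertible (O_YYs n)
}.

(* The correction A - B W^-1 C through which the transformation acts. *)
Definition dress (p q K : nat) (A : 'M[D]_(p, q)) (B : 'M[D]_(p, K))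
    (W : 'M[D]_K) (C : 'M[D]_(K, q)) : 'M[D]_(p, q) := A - B *m mxinv W *m C.

Definition sdress (K : nat) (h : D) (B : 'rV[D]_K) (W : 'M[D]_K)
    (C : 'cV[D]_K) : D := h - (B *m mxinv W *m C) 0 0.

End Lattice.

(* Main.v *)
(* All difference equations to be checked are instances of one matrix identity:
   if one lattice step changes A, B, C, W by z t, z s, y t, y s respectively,
   then it changes A - B W^-1 C by
     (z - B W^-1 y) (t - s W1^-1 C1),
   where W1 and C1 are the shifted W and C.  Its two factors are again dressed
   quantities.
   Inverting W by blocks through the Schur complement of its upper left block
   shows that this complement is invertible and that dressing with W is the
   same as dressing with the upper left block and then with the complement.
   The transform is quadrilateral because its elementary quadrilaterals lie in
   the affine span of the vectors X_i, X_j, which is contained in a plane even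
   when they are dependent. *)
Require Import Defs.
From mathcomp Require Import all_boot all_order all_algebra.
From mathcomp Require boolp.

Set Implicit Arguments.
Unset Strict Implicit.
Unset Printing Implicit Defensive.

Import GRing.Theory.
Local Open Scope ring_scope.

(** * Planes in a right vector space over a division ring *)

Section Columns.
Variables (D : unitRingType) (M : nat).

Definition independent_pair (u v : 'cV[D]_M) : Prop :=
  forall a b : D, u *m a%:M + v *m b%:M = 0 -> a = 0 /\ b = 0.

Definition in_span (u v y : 'cV[D]_M) : Prop :=
  exists a b : D, y = u *m a%:M + v *m b%:M.

Let scalar0 : 0%:M = 0 :> 'M[D]_1 := raddf0 _.

Lemma in_spanD u v y z : in_span u v y -> in_span u v z -> in_span u v (y + z).
Proof.
move=> [a [b ->]] [c [d ->]]; exists (a + c), (b + d).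
by rewrite !(raddfD (@scalar_mx D 1)) /= !mulmxDr addrACA.
Qed.

Lemma in_spanM u v y c : in_span u v y -> in_span u v (y *m c%:M).
Proof.
move=> [a [b ->]]; exists (a * c), (b * c).
by rewrite mulmxDl !scalar_mxM !mulmxA.
Qed.

Lemma in_span0 u v : in_span u v 0.
Proof. by exists 0, 0; rewrite scalar0 !mulmx0 addr0. Qed.

Lemma coplanar_in_span (p u v : 'cV[D]_M) (s : seq 'cV[D]_M) :
  independent_pair u v -> (forall y, y \in s -> in_span u v (y - p)) ->
  coplanar s.
Proof.
move=> indep_uv in_s; exists p, u, v; split=> // y /in_s [a [b def_y]].
by exists a, b; rewrite -addrA -def_y addrC subrK.
Qed.

Hypothesis divD : division_ring D.

Lemma div_mulf_eq0 (a b : D) : a * b = 0 -> a != 0 -> b = 0.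
Proof. by move=> ab0 /divD aU; rewrite -[b](mulKr aU) ab0 mulr0. Qed.

Hypothesis M_gt1 : (1 < M)%N.

(** Take [u = w], or the all-ones column if [w = 0]. If entry [k] of [u] is nonzero, a unit column
    at some [l != k] completes the pair: row [k] of a relation forces [a = 0], and then row [l]
    forces [b = 0]. *)
Lemma independent_completion (w : 'cV[D]_M) :
  exists u v, independent_pair u v /\ in_span u v w.
Proof.
have [u u_neq0 [c def_w]] :
    exists2 u : 'cV[D]_M, u != 0 & exists c, w = u *m c%:M.
  have [->|w_neq0] := eqVneq w 0; last first.
    by exists w => //; exists 1; rewrite mulmx1.
  exists (const_mx 1); last by exists 0; rewrite scalar0 mulmx0.
  apply/eqP=> /matrixP/(_ (Ordinal (ltnW M_gt1)) 0)/eqP.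
  by rewrite !mxE oner_eq0.
have [k uk_neq0] : exists k, u k 0 != 0.
  apply/existsP; apply: contraNT u_neq0 => /existsPn u0; apply/eqP/colP=> k.
  by have /negPn/eqP := u0 k; rewrite !mxE.
have [l neq_lk] : exists l : 'I_M, l != k.
  have [k0|k_neq0] := eqVneq (k : nat) 0%N.
    by exists (Ordinal M_gt1); rewrite -val_eqE /= k0.
  by exists (Ordinal (ltnW M_gt1)); rewrite -val_eqE /= eq_sym.
exists u, (delta_mx l 0); split; last first.
  by exists c, 0; rewrite scalar0 mulmx0 addr0.
move=> a b /colP rel; have a0 : a = 0.
  have := rel k; rewrite !mxE !big_ord1 !mxE (eq_sym k) (negPf neq_lk) mul0r addr0.
  by rewrite mulr1n => /div_mulf_eq0; apply.
split=> //; have := rel l.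
by rewrite a0 scalar0 mulmx0 add0r !mxE !big_ord1 !mxE !eqxx mul1r mulr1n.
Qed.

(** Supplies the independent directions that [coplanar] demands even when [y] and [z] are dependent:
    then one of them is a right multiple of the other, and completing the latter is enough. *)
Lemma independent_pair_spanning (y z : 'cV[D]_M) :
  exists u v, [/\ independent_pair u v, in_span u v y & in_span u v z].
Proof.
have [indep_yz|] := boolp.EM (independent_pair y z).
  exists y, z; split=> //.
    by exists 1, 0; rewrite scalar0 mulmx0 mulmx1 addr0.
  by exists 0, 1; rewrite scalar0 mulmx0 mulmx1 add0r.
have coll (y1 z1 : 'cV[D]_M) a b :
    b != 0 -> y1 *m a%:M + z1 *m b%:M = 0 ->
    exists u v, [/\ independent_pair u v, in_span u v y1 & in_span u v z1].
  move=> /divD bU rel; have [u [v [indep_uv uv_y]]] := independent_completion y1.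
  exists u, v; split=> //.
  suff ->: z1 = y1 *m (- a / b)%:M by exact: in_spanM.
  have/eqP: z1 *m b%:M = - (y1 *m a%:M) by apply/eqP; rewrite -addr_eq0 addrC rel.
  move=> /eqP zb; rewrite -[z1]mulmx1 -(divrr bU) !scalar_mxM !mulmxA zb.
  by rewrite (raddfN (@scalar_mx D 1)) /= mulmxN.
move=> /boolp.existsNP [a /boolp.existsNP [b /boolp.not_implyP [rel nab]]].
have [b0|b_neq0] := eqVneq b 0; last exact: coll rel.
have a_neq0 : a != 0 by apply/eqP=> a0; apply: nab.
rewrite addrC in rel; have [u [v [? ? ?]]] := coll _ _ _ _ a_neq0 rel.
by exists u, v.
Qed.

End Columns.

(** * Algebra of the correction A - B W^-1 C *)

Section Dressing.
Variable D : unitRingType.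

Lemma mxinv_unique K (A B : 'M[D]_K) : mx_inverse_of A B -> mxinv A = B.
Proof.
move=> invAB; have [AB BA] := invAB.
have [_ VA] : mx_inverse_of A (mxinv A) by apply: mxinvP; exists B.
by rewrite -[LHS]mulmx1 -AB mulmxA VA mul1mx.
Qed.

Lemma sdressE K (h : D) (B : 'rV[D]_K) (W : 'M[D]_K) (C : 'cV[D]_K) :
  (sdress h B W C)%:M = dress h%:M B W C.
Proof. by rewrite /sdress /dress raddfB /= -mx11_scalar. Qed.

Lemma scalar_mx11_inj (a b : D) : a%:M = b%:M :> 'M_1 -> a = b.
Proof. by move/matrixP/(_ 0 0); rewrite !mxE. Qed.

Lemma dress_step p q K (A A1 : 'M[D]_(p, q)) (B B1 : 'M[D]_(p, K))
    (W W1 : 'M[D]_K) (C C1 : 'M[D]_(K, q)) r (z : 'M[D]_(p, r))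
    (y : 'M[D]_(K, r)) (s : 'M[D]_(r, K)) (t : 'M[D]_(r, q)) :
    A1 - A = z *m t -> B1 - B = z *m s -> C1 - C = y *m t -> W1 - W = y *m s ->
    mx_invertible W -> mx_invertible W1 ->
  dress A1 B1 W1 C1 - dress A B W C = dress z B W y *m dress t s W1 C1.
Proof.
move=> dA dB dC dW /mxinvP[_ WV] /mxinvP[W1V _]; rewrite /dress.
set V := mxinv W in WV *; set V1 := mxinv W1 in W1V *.
have yt : B *m V *m (y *m t) = B *m V *m C1 - B *m V *m C.
  by rewrite -dC mulmxBr.
(* Resolvent identity V (W1 - W) V1 = V - V1, multiplied on the left by B. *)
have ys : B *m V *m (y *m s) *m V1 = B *m V - B *m V1.
  by rewrite -dW mulmxBr mulmxBl -(mulmxA B _ W) WV -mulmxA W1V !mulmx1.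
rewrite mulmxBl !mulmxBr -dA -!(mulmxA _ y) yt !mulmxA -dB -(mulmxA _ y) ys.
rewrite !mulmxBl !opprB (addrC (_ - B *m V1 *m C1)) subrKA.
rewrite -[RHS]addrA (addrC (B *m V1 *m C1 - _)) subrKA.
by rewrite addrACA [RHS]addrACA (addrC (- A)).
Qed.

(** The off-diagonal equations aq + bs = 0 of WV = 1 and ra + sc = 0 of VW = 1 give q and r in terms
    of s. Substituted into cq + ds = 1 and rb + sd = 1, they make s a two-sided inverse of the Schur
    complement; pa + qc = 1 then gives p. *)
Lemma block_inverse_dress Ka Kb (W : 'M[D]_(Ka + Kb)) (V : 'M[D]_(Ka + Kb)) :
    mx_invertible (ulsubmx W) -> mx_inverse_of W V ->
  let V_ba := dlsubmx V in let V_ab := ursubmx V in let V_bb := drsubmx V in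
  let Waa' := mxinv (ulsubmx W) in
  [/\ mx_inverse_of (dress (drsubmx W) (dlsubmx W) (ulsubmx W) (ursubmx W)) V_bb,
      V_ab = - (Waa' *m ursubmx W *m V_bb),
      V_ba = - (V_bb *m dlsubmx W *m Waa')
    & ulsubmx V = Waa' + Waa' *m ursubmx W *m V_bb *m dlsubmx W *m Waa'].
Proof.
move=> /mxinvP[aa' a'a] [] /=.
rewrite -[W *m V](f_equal2 mulmx (submxK W) (submxK V)).
rewrite -[V *m W](f_equal2 mulmx (submxK V) (submxK W)).
rewrite /dress !mulmx_block scalar_mx_block.
move: (ulsubmx W) (ursubmx W) (dlsubmx W) (drsubmx W) aa' a'a => a b c d.
move: (mxinv a) => a' aa' a'a.
move: (ulsubmx V) (ursubmx V) (dlsubmx V) (drsubmx V) => p q r s.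
move=> /eq_block_mx[_ aq_bs _ cq_ds] /eq_block_mx[pa_rc' pb_qd ra_sc rb_sd].
have q_def : q = - (a' *m b *m s).
  apply/eqP; rewrite -addr_eq0 -[q]mul1mx -a'a -!mulmxA -mulmxDr aq_bs.
  by rewrite mulmx0.
have r_def : r = - (s *m c *m a').
  apply/eqP; rewrite -addr_eq0 -[r]mulmx1 -aa' !mulmxA -mulmxDl ra_sc.
  by rewrite mul0mx.
split=> //.
  split; first by rewrite -cq_ds q_def mulmxN mulmxBl !mulmxA addrC.
  by rewrite -rb_sd r_def mulNmx mulmxBr !mulmxA addrC.
have : p *m a *m a' = (1%:M - q *m c) *m a' by rewrite -pa_rc' addrK.
rewrite -mulmxA aa' mulmx1 => ->.
by rewrite q_def mulNmx opprK mulmxDl mul1mx.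
Qed.

(** With W = (a b; c d) and s the inverse of its Schur complement, the block inverse factors the
    correction as Ba a^-1 Ca + (Bb - Ba a^-1 b) s (Cb - c a^-1 Ca). *)
Lemma dress_block p q Ka Kb (A : 'M[D]_(p, q)) (B : 'M[D]_(p, Ka + Kb))
    (W : 'M[D]_(Ka + Kb)) (C : 'M[D]_(Ka + Kb, q)) :
    mx_invertible W -> mx_invertible (ulsubmx W) ->
  dress A B W C =
  dress (dress A (lsubmx B) (ulsubmx W) (usubmx C))
        (dress (rsubmx B) (lsubmx B) (ulsubmx W) (ursubmx W))
        (dress (drsubmx W) (dlsubmx W) (ulsubmx W) (ursubmx W))
        (dress (dsubmx C) (dlsubmx W) (ulsubmx W) (usubmx C)).
Proof.
move=> /mxinvP W_inv Waa_inv.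
have [/mxinv_unique Wbb' q_def r_def p_def] := block_inverse_dress Waa_inv W_inv.
rewrite {1 2 3}/dress Wbb' -[in LHS](hsubmxK B) -[in LHS](vsubmxK C).
rewrite -[in LHS](submxK (mxinv W)) mul_row_block mul_row_col q_def r_def p_def.
rewrite /dress -addrA -opprD; congr (_ - _).
(* Both sides expand to the same five products; only their order differs. *)
rewrite !(mulmxDl, mulmxDr, mulmxBl, mulmxBr, mulmxN, mulNmx) !mulmxA.
rewrite opprK -!addrA; congr (_ + _).
by rewrite addrA [RHS]addrA [RHS]addrC; congr (_ + _); exact: addrC.
Qed.
End Dressing.

(** * Transforms of lattices and of their forward data *)

Section Lattice.
Variables (D : unitRingType) (N M : nat).
Variables (x : 'rV[int]_N -> 'cV[D]_M).
Variables (X : 'I_N -> 'rV[int]_N -> 'cV[D]_M) (H : 'I_N -> 'rV[int]_N -> D).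
Variable Q : 'I_N -> 'I_N -> 'rV[int]_N -> D.
Hypothesis fwd : forward_data x X H Q.

Lemma forward_data_quadrilateral :
  division_ring D -> (1 < M)%N -> quadrilateral_lattice x.
Proof.
move=> divD M_gt1 i j n neq_ij.
have [u [v [indep Xi Xj]]] := independent_pair_spanning divD M_gt1 (X i n) (X j n).
have Xspan k c : k \in [:: i; j] -> in_span u v (X k n *m c%:M).
  by rewrite !inE => /orP[]/eqP->; exact: in_spanM.
apply: (coplanar_in_span (p := x n) indep) => y; rewrite !inE.
have dx k m : Tr k x m - x m = X k m *m (Tr k (H k) m)%:M := fd_x fwd k m.
have dXi : Tr j (X i) n = X i n + X j n *m (Tr j (Q i j) n)%:M.
  by rewrite -(fd_X fwd) // /Df addrC subrK.
case/or4P=> /eqP->.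
- by rewrite subrr; exact: in_span0.
- by rewrite dx; apply: Xspan; rewrite !inE eqxx.
- by rewrite dx; apply: Xspan; rewrite !inE eqxx orbT.
(* The opposite vertex is reached by a [j]-edge, then an [i]-edge. The direction of the latter is
   T_j X_i, which [dXi] keeps in the span of X_i and X_j. *)
have -> : Tr i (Tr j x) n - x n =
    Tr j (X i) n *m (Tr j (Tr i (H i)) n)%:M + X j n *m (Tr j (H j) n)%:M.
  rewrite -dx -(subrKA (Tr j x n)); congr (_ + _).
  by rewrite /Tr [n + _ + _]addrAC; exact: dx.
rewrite dXi; do 2?[apply: in_spanD; last first]; do ?exact: in_spanM.
by apply: in_spanM; apply: in_spanD => //; exact: in_spanM.
Qed.

Variable K : nat.
Variable Y : 'I_N -> 'rV[int]_N -> 'cV[D]_K.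
Variable Ys : 'I_N -> 'rV[int]_N -> 'rV[D]_K.
Variables (O_YYs : 'rV[int]_N -> 'M[D]_K) (O_XYs : 'rV[int]_N -> 'M[D]_(M, K)).
Variable O_YH : 'rV[int]_N -> 'cV[D]_K.
Hypothesis vft : vft_data X H Q Y Ys O_YYs O_XYs O_YH.

(** [dress_step] with y = Y_i and s = T_i Y*_i, as [O_YYs] is a potential. Leaving A, B, C, z, t
    free lets it serve both the forward data and any further data that are carried along. *)
Lemma dress_Df p q i n (A : 'rV[int]_N -> 'M[D]_(p, q))
    (B : 'rV[int]_N -> 'M[D]_(p, K)) (C : 'rV[int]_N -> 'M[D]_(K, q))
    (z : 'cV[D]_p) (t : 'rV[D]_q) :
    Df i A n = z *m t -> Df i B n = z *m Tr i (Ys i) n ->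
    Df i C n = Y i n *m t ->
  Df i (fun m => dress (A m) (B m) (O_YYs m) (C m)) n =
  dress z (B n) (O_YYs n) (Y i n)
    *m dress t (Tr i (Ys i) n) (Tr i O_YYs n) (Tr i C n).
Proof.
move=> dA dB dC; apply: dress_step => //; first exact: (vft_YYs vft).
  exact: (vft_inv vft).
exact: (vft_inv vft).
Qed.

Lemma sdress_Df i n (h : 'rV[int]_N -> D) (B : 'rV[int]_N -> 'rV[D]_K)
    (C : 'rV[int]_N -> 'cV[D]_K) (z t : D) :
    Df i h n = z * t -> Df i B n = z *: Tr i (Ys i) n ->
    Df i C n = Y i n *m t%:M ->
  Df i (fun m => sdress (h m) (B m) (O_YYs m) (C m)) n =
  sdress z (B n) (O_YYs n) (Y i n)
    * sdress t (Tr i (Ys i) n) (Tr i O_YYs n) (Tr i C n).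
Proof.
move=> dh dB dC; apply: scalar_mx11_inj; rewrite scalar_mxM !sdressE.
rewrite /Df /Tr raddfB /= !sdressE.
apply: (@dress_Df _ _ _ _ (fun m => (h m)%:M)) => //.
  by rewrite -scalar_mxM -dh /Df raddfB.
by rewrite mul_scalar_mx.
Qed.

Lemma vft_forward_data :
  forward_data (fun n => dress (x n) (O_XYs n) (O_YYs n) (O_YH n))
    (fun i n => dress (X i n) (O_XYs n) (O_YYs n) (Y i n))
    (fun i n => sdress (H i n) (Ys i n) (O_YYs n) (O_YH n))
    (fun i j n => sdress (Q i j n) (Ys j n) (O_YYs n) (Y i n)).
Proof.
split=> [i n|i j n neq_ij|i j n neq_ij|i j k n neq_ij neq_jk neq_ik].
- rewrite /Tr sdressE; apply: dress_Df; first exact: (fd_x fwd).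
    exact: (vft_XYs vft).
  exact: (vft_YH vft).
- apply: sdress_Df; first exact: (fd_H fwd).
    exact: (vft_Ys vft).
  exact: (vft_YH vft).
- rewrite /Tr sdressE; apply: dress_Df; first exact: (fd_X fwd).
    exact: (vft_XYs vft).
  exact: (vft_Y vft).
- apply: sdress_Df; first exact: (fd_Q fwd).
    by apply: (vft_Ys vft); rewrite eq_sym.
  exact: (vft_Y vft).
Qed.

End Lattice.

(** * Superposition of two transformations *)

Theorem proposition2 (D : unitRingType) (hD : division_ring D)
    (M N Ka Kb : nat) (hN : (3 <= N)%N) (hM : (N <= M)%N)
    (hKa : (1 <= Ka)%N) (hKb : (1 <= Kb)%N)
    (x : 'rV[int]_N -> 'cV[D]_M)
    (X : 'I_N -> 'rV[int]_N -> 'cV[D]_M) (H : 'I_N -> 'rV[int]_N -> D)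
    (Q : 'I_N -> 'I_N -> 'rV[int]_N -> D)
    (Y : 'I_N -> 'rV[int]_N -> 'cV[D]_(Ka + Kb))
    (Ys : 'I_N -> 'rV[int]_N -> 'rV[D]_(Ka + Kb))
    (O_YYs : 'rV[int]_N -> 'M[D]_(Ka + Kb))
    (O_XYs : 'rV[int]_N -> 'M[D]_(M, Ka + Kb))
    (O_YH : 'rV[int]_N -> 'cV[D]_(Ka + Kb))
    (x_quad : quadrilateral_lattice x)
    (x_fwd : forward_data x X H Q)
    (Y_vft : vft_data X H Q Y Ys O_YYs O_XYs O_YH)
    (Oaa_inv : forall n, mx_invertible (ulsubmx (O_YYs n))) :
  let x' := fun n => dress (x n) (O_XYs n) (O_YYs n) (O_YH n) in
  let Ya := fun i n => usubmx (Y i n) in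
  let Yb := fun i n => dsubmx (Y i n) in
  let Ysa := fun i n => lsubmx (Ys i n) in
  let Ysb := fun i n => rsubmx (Ys i n) in
  let O_YaH := fun n => usubmx (O_YH n) in
  let O_YbH := fun n => dsubmx (O_YH n) in
  let O_XYsa := fun n => lsubmx (O_XYs n) in
  let O_XYsb := fun n => rsubmx (O_XYs n) in
  let O_aa := fun n => ulsubmx (O_YYs n) in
  let O_ab := fun n => ursubmx (O_YYs n) in
  let O_ba := fun n => dlsubmx (O_YYs n) in
  let O_bb := fun n => drsubmx (O_YYs n) in
  let x_a := fun n => dress (x n) (O_XYsa n) (O_aa n) (O_YaH n) in
  let X_a := fun i n => dress (X i n) (O_XYsa n) (O_aa n) (Ya i n) in
  let H_a := fun i n => sdress (H i n) (Ysa i n) (O_aa n) (O_YaH n) in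
  let Q_a := fun i j n => sdress (Q i j n) (Ysa j n) (O_aa n) (Ya i n) in
  let Yb_a := fun i n => dress (Yb i n) (O_ba n) (O_aa n) (Ya i n) in
  let Ysb_a := fun i n => dress (Ysb i n) (Ysa i n) (O_aa n) (O_ab n) in
  let O_YbH_a := fun n => dress (O_YbH n) (O_ba n) (O_aa n) (O_YaH n) in
  let O_bb_a := fun n => dress (O_bb n) (O_ba n) (O_aa n) (O_ab n) in
  let O_XYsb_a := fun n => dress (O_XYsb n) (O_XYsa n) (O_aa n) (O_ab n) in
  [/\ vft_data X H Q Ya Ysa O_aa O_XYsa O_YaH,
      quadrilateral_lattice x_a,
      forward_data x_a X_a H_a Q_a,
      vft_data X_a H_a Q_a Yb_a Ysb_a O_bb_a O_XYsb_a O_YbH_a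
    & forall n, x' n = dress (x_a n) (O_XYsb_a n) (O_bb_a n) (O_YbH_a n)].
Proof.
move=> x' Ya Yb Ysa Ysb O_YaH O_YbH O_XYsa O_XYsb O_aa O_ab O_ba O_bb x_a X_a H_a.
move=> Q_a Yb_a Ysb_a O_YbH_a O_bb_a O_XYsb_a.
(* Restricting the equations of the full data to rows or columns gives those of the blocks, since
   block extraction is additive. *)
have vft_a : vft_data X H Q Ya Ysa O_aa O_XYsa O_YaH.
  split=> [i j n neq|i j n neq|i n|i n|i n|//].
  - by rewrite /Ya mul_usub_mx -(vft_Y Y_vft) // /Df raddfB.
  - by rewrite /Ysa -linearZ -(vft_Ys Y_vft) // /Df raddfB.
  - by rewrite /Ya /Ysa /Tr mulmx_lsub mul_usub_mx -(vft_YYs Y_vft) /Df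
    !raddfB.
  - by rewrite /Ysa /Tr mulmx_lsub -(vft_XYs Y_vft) /Df raddfB.
  - by rewrite /Ya mul_usub_mx -(vft_YH Y_vft) /Df raddfB.
have fwd_a := vft_forward_data x_fwd vft_a.
have M_gt1 : (1 < M)%N := leq_trans (ltnW hN) hM.
(* The b-blocks and mixed blocks over the undressed lattice: they are the inputs A, B, C of
   [dress_Df] for the second transformation, [O_ba] entering as B and [O_ab] as C. *)
have dYb i j n : i != j -> Df j (Yb i) n = Yb j n *m (Tr j (Q i j) n)%:M.
  by move=> neq; rewrite /Yb mul_dsub_mx -(vft_Y Y_vft) // /Df raddfB.
have dYsb i j n : i != j -> Df i (Ysb j) n = Q i j n *: Tr i (Ysb i) n.
  by move=> neq; rewrite /Ysb -linearZ -(vft_Ys Y_vft) // /Df raddfB.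
have dO_ab : potential Ya Ysb O_ab.
  by move=> i n; rewrite /Ya /Ysb /Tr mulmx_rsub mul_usub_mx -(vft_YYs Y_vft) /Df
    !raddfB.
have dO_ba : potential Yb Ysa O_ba.
  by move=> i n; rewrite /Yb /Ysa /Tr mulmx_lsub mul_dsub_mx -(vft_YYs Y_vft) /Df
    !raddfB.
have dO_bb : potential Yb Ysb O_bb.
  by move=> i n; rewrite /Yb /Ysb /Tr mulmx_rsub mul_dsub_mx -(vft_YYs Y_vft) /Df
    !raddfB.
have dO_XYsb : potential X Ysb O_XYsb.
  by move=> i n; rewrite /Ysb /Tr mulmx_rsub -(vft_XYs Y_vft) /Df raddfB.
have dO_YbH : potential Yb (fun i n => (H i n)%:M) O_YbH.
  by move=> i n; rewrite /Yb mul_dsub_mx -(vft_YH Y_vft) /Df raddfB.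
split=> //; first exact: forward_data_quadrilateral fwd_a hD M_gt1.
  split=> [i j n neq|i j n neq|i n|i n|i n|n].
  - rewrite /Tr sdressE; apply: (dress_Df vft_a); [exact: dYb|exact: dO_ba|].
    exact: (vft_Y vft_a).
  (* The scalar factor becomes a 1 x 1 matrix on the left, so that [Q_a] appears as the dressed
     factor z. *)
  - rewrite -mul_scalar_mx sdressE; apply: (dress_Df vft_a).
    + by rewrite mul_scalar_mx; exact: dYsb.
    + by rewrite mul_scalar_mx; exact: (vft_Ys vft_a).
    + exact: dO_ab.
  - by apply: (dress_Df vft_a).
  - by apply: (dress_Df vft_a) => //; exact: (vft_XYs vft_a).
  - rewrite /Tr sdressE; apply: (dress_Df vft_a); [exact: dO_YbH|exact: dO_ba|].
    exact: (vft_YH vft_a).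
  - have [inv_bb _ _ _] := block_inverse_dress (Oaa_inv n) (mxinvP (vft_inv Y_vft n)).
    (* [O_bb_a] is the Schur complement, inverted by the lower right block of the full inverse. *)
    by exists (drsubmx (mxinv (O_YYs n))).
by move=> n; apply: dress_block => //; exact: (vft_inv Y_vft).
Qed.
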